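(* For every prime power $q$ and every integer $n\ge 2$, there exists an automata network $F:\mathrm{GF}(q)^n\to\mathrm{GF}(q)^n$ of degree at most $2$ which is near-Hamiltonian, i.e. whose dynamics consists of exactly one fixed point and one cycle of length $q^n-1$.
   Context: An automata network is a map $F:Q^V\to Q^V$, $V=\{1,\dots,n\}$, with local functions $f_j(x)=F(x)_j$. Its interaction graph has an arc $(i,j)$ iff $f_j$ effectively depends on $x_i$ (there exist $x,x'$ differing only at $i$ with $f_j(x)\neq f_j(x')$). The degree of $F$ is the maximum in-degree of its interaction graph. The dynamics of $F$ is the functional graph $x\mapsto F(x)$ on $Q^V$. *)

(* Defs.v *)
From mathcomp Require Import all_boot all_order all_algebra.

Set Implicit Arguments.
Unset Strict Implicit.
Unset Printing Implicit Defensive.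

(* Vertices are numbered 0, ..., n-1 instead of 1, ..., n. *)
Definition config (Q : finType) (n : nat) : finType := {ffun 'I_n -> Q}.

Definition automata_network (Q : finType) (n : nat) : Type :=
  config Q n -> config Q n.

Section AutomataNetworks.

Variables (Q : finType) (n : nat).
Implicit Type F : automata_network Q n.

(* Loops (i, i) are allowed, and count in the in-degree of i. *)
Definition interaction_graph F : rel 'I_n := fun i j =>
  [exists x : config Q n, exists x' : config Q n,
    [forall k : 'I_n, (k != i) ==> (x k == x' k)] && (F x j != F x' j)].

Definition in_degree F (j : 'I_n) : nat :=
  #|[set i : 'I_n | interaction_graph F i j]|.

Definition degree F : nat := \max_(j < n) in_degree F j.

(* The perm_eq condition says that each configuration occurs exactly once in  *)
(* x :: c, so that the functional graph of F is the disjoint union of the     *)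
(* loop at x and the cycle c.                                                 *)
Definition near_hamiltonian F : Prop :=
  exists (x : config Q n) (c : seq (config Q n)),
    [/\ F x = x,
        ufcycle F c,
        size c = #|Q| ^ n - 1
      & perm_eq (x :: c) (enum (config Q n))].

End AutomataNetworks.

(* Main.v *)
Require Import Defs.
From mathcomp Require Import all_boot all_order all_algebra.
From mathcomp Require Import all_fingroup all_solvable all_field.

(* Let [a] be a generator of the multiplicative group of GF(q^n).  Then
   [1, a, ..., a^(n-1)] is a basis of GF(q^n) over GF(q), and multiplication by
   [a] fixes [0] and permutes the other elements in a single cycle.  In this
   basis it is a companion matrix: the coordinate [j] of [a * x] is
   [x_(j-1) + c_j * x_(n-1)], which involves two coordinates of [x] only. *)

Import GRing.Theory.
Local Open Scope ring_scope.

(* The roots of ['X^m - 'X], [m = #|K| ^ n], are simple and form the fixed field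
   of the [n]-th power of the Frobenius, hence all of the splitting field. *)
Lemma fieldExt_of_dim (K : finFieldType) (n : nat) :
  (0 < n)%N -> exists L : fieldExtType K, \dim {:L} = n.
Proof.
move=> n_gt0; set m := (#|K| ^ n)%N.
have m_gt1 : (1 < m)%N by rewrite (ltn_exp2l 0) ?finNzRing_gt1.
pose f (R : nzRingType) : {poly R} := 'X^m - 'X.
have size_f (R : nzRingType) : size (f R) = m.+1.
  by rewrite size_polyDl size_polyXn // size_polyN size_polyX.
have /FinSplittingFieldFor[L] : f K != 0 by rewrite -size_poly_eq0 size_f.
rewrite rmorphB rmorphXn /= map_polyX -/(f L) => -[zs Df defL].
(* [m] is a power of the characteristic with nonzero exponent, since [#|K|] is not 1 and [n] is
   positive. *)
have m0 : m%:R = 0 :> L.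
  have [p p_pr pcharK] := finPcharP K; have := pcharK.
  rewrite -(pchar_lalg L) => /pcharf0 p0.
  rewrite /m (card_pprimeChar pcharK) -expnM natrX p0 expr0n.
  have := card_pprimeChar pcharK; case: (logn _ _) => [|k _].
    by move=> K1; have := finNzRing_gt1 K; rewrite K1.
  by rewrite muln_eq0 /= eqn0Ngt n_gt0.
(* By [m0], the derivative of ['X^m - 'X] is the constant -1, which is coprime to everything. *)
have Uzs : uniq zs.
  rewrite -separable_prod_XsubC -(eqp_separable Df) unlock.
  rewrite derivB derivXn derivX -mulr_natl -polyC_natr m0 mul0r sub0r.
  by rewrite -scaleN1r coprimepZr ?oppr_eq0 ?oner_eq0 // coprimep1.
have [s _ Ds] := finField_galois_generator (sub1v {:L}).
rewrite dimv1 expn1 in Ds.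
pose E := fixedSpace (s ^+ n)%g.
(* [s] raises to the power [#|K|], so [s ^+ n] raises to the power [m]. *)
have in_zs : zs =i E.
  move=> z; rewrite -root_prod_XsubC -(eqp_root Df) (sameP fixedSpaceP eqP).
  rewrite /root !hornerE subr_eq0 /m; congr (_ == z).
  elim: (n) => [|i IHi]; first by rewrite gal_id.
  by rewrite expgSr expnSr exprM IHi galM ?Ds ?memvf.
have defE : E = {:L}%VS.
  apply/eqP; rewrite eqEsubv subvf -defL -[E]subfield_closed agenvS //.
  by rewrite subv_add sub1v; apply/span_subvP=> z; rewrite in_zs.
exists L; apply/eqP; rewrite -(eqn_exp2l _ _ (finNzRing_gt1 K)) -/m.
rewrite -(@card_vspace K _ (Vector.on (finvect_type L))) card_vspacef.
have -> : #|finvect_type L| = size zs.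
  rewrite -(card_uniqP (T := finvect_type L) Uzs); apply: eq_card => z.
  by rewrite in_zs defE memvf.
by rewrite -eqSS -(size_prod_XsubC _ id) -(eqp_size Df) size_f.
Qed.

Lemma expf_card_pred (L : finFieldType) (x : L) : x != 0 -> x ^+ #|L|.-1 = 1.
Proof.
move=> x0; apply: (mulfI x0); rewrite -exprS prednK ?expf_card ?mulr1 //.
exact: ltnW (finNzRing_gt1 L).
Qed.

(** The nonzero elements are [#|L|.-1] distinct roots of unity of exponent [#|L|.-1]; that many
    force one of them to be primitive. *)
Lemma finField_prim_root (L : finFieldType) :
  exists g : L, (#|L|.-1).-primitive_root g.
Proof.
have L1 : (0 < #|L|.-1)%N by rewrite -subn1 subn_gt0 finNzRing_gt1.
have /hasP[g _ gP] : has (#|L|.-1).-primitive_root (enum (predC1 (0 : L))).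
  apply: has_prim_root; rewrite ?enum_uniq //.
    apply/allP => x; rewrite mem_enum inE /= => x0; rewrite unity_rootE.
    by rewrite expf_card_pred.
  by rewrite -cardE cardC1.
by exists g.
Qed.

Lemma near_hamiltonian_conj_prim_root (Q : finType) (n : nat)
    (F : automata_network Q n) (L : finFieldType) (g : L)
    (phi : config Q n -> L) :
  (#|L|.-1).-primitive_root g -> bijective phi ->
  (forall x, phi (F x) = g * phi x) -> near_hamiltonian F.
Proof.
move=> gP phi_bij phiF; set N := #|L|.-1 in gP.
have [psi phiK psiK] := phi_bij; have inj_phi := can_inj phiK.
have N_gt0 : (0 < N)%N := prim_order_gt0 gP.
have g0 : g != 0.
  by have := oner_neq0 L; rewrite -(prim_expr_order gP) expf_eq0 N_gt0.
have F_iter i : phi (iter i F (psi 1)) = g ^+ i.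
  by elim: i => [|i IHi] /=; rewrite ?psiK // phiF IHi exprS.
(* [phi] carries the orbit of [psi 1] to the powers of [g], which are all the nonzero elements. *)
have inc x : (x \in traject F (psi 1) N) = (phi x != 0).
  apply/trajectP/idP => [[i _ ->]|x0]; first by rewrite F_iter expf_neq0.
  have /(prim_rootP gP)[i Di] := expf_card_pred L (phi x) x0.
  by exists i => //; apply: inj_phi; rewrite F_iter.
have Uc : uniq (traject F (psi 1) N).
  (* A repetition would equate two powers of [g] with distinct exponents below its order. *)
  case: N N_gt0 {inc} gP => // N _ gP; rewrite looping_uniq.
  apply/trajectP => -[i ltiN] /(congr1 phi) /eqP; rewrite !F_iter.
  by rewrite (eq_prim_root_expr gP) !modn_small ?gtn_eqF // ltnW.
have Q_card : #|L| = (#|Q| ^ n)%N.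
  by rewrite -(bij_eq_card phi_bij) card_ffun card_ord.
exists (psi 0), (traject F (psi 1) N); split.
- by apply: inj_phi; rewrite phiF psiK mulr0.
- rewrite /ucycle Uc andbT; case: N N_gt0 gP {inc Uc} => // N _ gP.
  rewrite /= rcons_path fpath_traject last_traject /=; apply/eqP/inj_phi.
  by rewrite phiF F_iter -exprS (prim_expr_order gP) psiK.
- by rewrite size_traject -Q_card subn1.
apply: uniq_perm; rewrite /= ?enum_uniq ?inc ?psiK ?eqxx //.
move=> x; rewrite mem_enum !inE inc.
by rewrite -(inj_eq inj_phi) psiK orbN.
Qed.

Lemma degree_le2 (Q : finType) (n : nat) (F : automata_network Q n)
    (u v : 'I_n -> 'I_n) :
  (forall (x x' : config Q n) j,
    x (u j) = x' (u j) -> x (v j) = x' (v j) -> F x j = F x' j) ->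
  (degree F <= 2)%N.
Proof.
move=> F_uv; apply/bigmax_leqP => j _.
apply: (@leq_trans #|[set u j; v j]|); last by rewrite cards2; case: (_ == _).
apply/subset_leq_card/subsetP => i; rewrite !inE.
case/existsP => x /existsP[x' /andP[/forallP xx' neqF]].
apply: contraNT neqF; rewrite negb_or => /andP[iu iv].
by apply/eqP/F_uv; apply/eqP/(implyP (xx' _)); rewrite eq_sym.
Qed.

Section PowerBasis.

Variables (K : finFieldType) (L : fieldExtType K) (m : nat) (a : L).
Hypotheses (dimL : \dim {:L} = m.+1) (La : <<1; a>>%VS = {:L}%VS).

Definition power_sum (x : config K m.+1) : finvect_type L :=
  \sum_(i < m.+1) x i *: a ^+ i.

(** Both sides have [#|K| ^ m.+1] elements, so injectivity suffices. Two configurations with the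
    same image differ by the coefficients of a polynomial of degree at most [m] that vanishes at
    [a], whereas [a] has degree [m.+1] over [K]. *)
Lemma power_sum_bij : bijective power_sum.
Proof.
apply: inj_card_bij => [x y xy|]; last first.
  rewrite -(@card_vspacef K _ (Vector.on (finvect_type L))).
  rewrite (@card_vspace K _ (Vector.on (finvect_type L))).
  by rewrite [\dim _]dimL card_ffun card_ord.
pose p := \poly_(i < m.+1) (x (inord i) - y (inord i)).
have p0 : map_poly (in_alg L) p == 0.
  have deg_a : adjoin_degree 1 a = m.+1.
    by have := dim_Fadjoin 1 a; rewrite La dimL dimv1 muln1.
  rewrite -(root_small_adjoin_poly (K := 1%AS) (x := a)) ?alg_polyOver //.
    apply/rootP; transitivity (power_sum x - power_sum y); last first.
      by rewrite xy subrr.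
    rewrite (horner_coef_wide a (n := m.+1)) ?size_map_poly ?size_poly //.
    rewrite -sumrB; apply: eq_bigr => i _.
    by rewrite coef_map coef_poly ltn_ord inord_val mulr_algl scalerBl.
  by rewrite size_map_poly deg_a size_poly.
apply/ffunP => i; apply/eqP; rewrite -subr_eq0.
move: p0; rewrite map_poly_eq0 => /eqP/(congr1 (fun r : {poly K} => r`_i)).
by rewrite coef_poly ltn_ord inord_val coef0 => ->.
Qed.

(* The first summand is the shift [x_(j-1)], cut off at [j = 0]. *)
Definition companion (c : config K m.+1) : automata_network K m.+1 :=
  fun x => [ffun j : 'I_m.+1 =>
    x (inord j.-1) *+ (j != ord0) + c j * x ord_max].

Lemma companion_degree c : (degree (companion c) <= 2)%N.
Proof.
apply: (@degree_le2 _ _ _ (fun j => inord j.-1) (fun=> ord_max)) => x x' j.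
by rewrite !ffunE => -> ->.
Qed.

(** Multiplication by [a] shifts every term but the last, whose [a ^+ m.+1] is expanded back in the
    basis with coefficients [c]. *)
Lemma power_sum_companion c x :
  power_sum c = a ^+ m.+1 -> power_sum (companion c x) = a * power_sum x.
Proof.
rewrite /power_sum => Dc.
under eq_bigr do rewrite ffunE scalerDl [c _ * _]mulrC -scalerA.
rewrite big_split -scaler_sumr Dc /= big_ord_recl mulr0n scale0r add0r.
rewrite [in RHS]big_ord_recr mulrDr -scalerAr -exprS; congr (_ + _).
rewrite mulr_sumr; apply: eq_bigr => i _ /=.
rewrite -scalerAr -exprS mulr1n.
have -> : inord (0 + i) = widen_ord (leqnSn m) i :> 'I_m.+1; last by [].
by apply: val_inj; rewrite /= inordK // (leq_trans (ltn_ord i)).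
Qed.

End PowerBasis.

(** Every nonzero element of [L] is already a power of [a]. *)
Lemma prim_root_generates (K : finFieldType) (L : fieldExtType K)
    (a : finvect_type L) :
  (#|finvect_type L|.-1).-primitive_root a -> <<1; (a : L)>>%VS = {:L}%VS.
Proof.
move=> aP; apply/eqP; rewrite eqEsubv subvf; apply/subvP => x _.
have [->|x0] := eqVneq x 0; first exact: mem0v.
have /(prim_rootP aP)[i ->] : (x : finvect_type L) ^+ #|finvect_type L|.-1 = 1.
  exact: expf_card_pred.
by rewrite rpredX // memv_adjoin.
Qed.

Lemma ex_companion_near_hamiltonian (K : finFieldType) (m : nat) :
  exists c : config K m.+1, near_hamiltonian (companion K m c).
Proof.
have [L dimL] := @fieldExt_of_dim K m.+1 isT.
have [a aP] := finField_prim_root (finvect_type L).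
have phi_bij := power_sum_bij _ _ _ _ dimL (prim_root_generates _ _ _ aP).
(* The last column of the companion matrix consists of the coordinates of [a ^+ m.+1]. *)
have [psi _ psiK] := phi_bij; exists (psi (a ^+ m.+1)).
apply: (near_hamiltonian_conj_prim_root _ _ _ _ _ _ aP phi_bij) => x.
by apply: power_sum_companion; apply: psiK.
Qed.

Local Close Scope ring_scope.

Theorem theorem2 (p k q n : nat) (K : finFieldType)
    (p_prime : prime p) (k_gt0 : 0 < k) (q_def : q = p ^ k)
    (cardK : #|K| = q) (n_ge2 : 2 <= n) :
  exists F : automata_network K n, degree F <= 2 /\ near_hamiltonian F.
Proof.
case: n n_ge2 => // m _; have [c cF] := ex_companion_near_hamiltonian K m.
by exists (companion K m c); split; first exact: companion_degree.
Qed.
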